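(* Let $(\Omega,\Sigma,\mu)$ be a finite measure space, $X$ a real Banach space and $Y$ a separable closed linear subspace of $X$; regard $L_p(\Sigma,Y)\subseteq L_p(\Sigma,X)$ for $1\le p\le\infty$. Write $\mathcal{F}(Z)$ for the family of nonempty finite subsets (finite tuples) of a Banach space $Z$. Then: (a) $(X,Y,\mathcal{F}(X))$ has the restricted weighted Chebyshev center property if and only if $(L_\infty(\Sigma,X),L_\infty(\Sigma,Y),\mathcal{F}(L_\infty(\Sigma,X)))$ has the restricted weighted Chebyshev center property. (b) For $1\le p<\infty$, $(X,Y,\mathcal{F}(X))$ has the restricted $\mathscr{F}_p$-center property if and only if $(L_p(\Sigma,X),L_p(\Sigma,Y),\mathcal{F}(L_p(\Sigma,X)))$ has the restricted $\mathscr{F}_p$-center property.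
   Context: For $1\le p<\infty$, $L_p(\Sigma,X)$ is the Banach space of $p$-Bochner integrable (strongly measurable) functions $\Omega\to X$ with norm $\|f\|_p=(\int_\Omega\|f(t)\|^p\,d\mu(t))^{1/p}$; $L_\infty(\Sigma,X)$ is the space of strongly measurable essentially bounded functions $\Omega\to X$ with the essential supremum norm. For $1\le p<\infty$, $\mathscr{F}_p=(f_p^n)_{n=1}^\infty$, where $f_p^n:\mathbb{R}^n_{\ge0}\to\mathbb{R}_{\ge0}$, $f_p^n(\alpha_1,\dots,\alpha_n)=\left(\sum_{i=1}^n|\alpha_i|^p\right)^{1/p}$. Let $W$ be a closed linear subspace of a Banach space $Z$. The triplet $(Z,W,\mathcal{F}(Z))$ has the restricted weighted Chebyshev center property if for every $n\ge 1$, every tuple $(z_1,\dots,z_n)$ in $Z$ and all weights $\rho_1,\dots,\rho_n\ge0$ the infimum $\inf_{w\in W}\max_i\rho_i\|w-z_i\|$ is attained at some $w\in W$. The triplet has the restricted $\mathscr{F}_p$-center property if for every $n\ge 1$ and every tuple $(z_1,\dots,z_n)$ in $Z$ the infimum $\inf_{w\in W}f_p^n(\|w-z_1\|,\dots,\|w-z_n\|)$ is attained at some $w\in W$.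
   Formalization: The finite measure μ is assumed nonzero (μ(Ω) > 0): for μ = 0 all spaces L_p(Σ,X) are {0} and have both center properties, while (X,Y) need not, so the ''if'' directions would fail. *)

(* Defs.v *)
From HB Require Import structures.
From mathcomp Require Import all_boot all_order all_algebra.
From mathcomp Require Import all_classical all_reals all_analysis.
From mathcomp Require Import ess_sup_inf measurable_realfun.

Set Implicit Arguments.
Unset Strict Implicit.
Unset Printing Implicit Defensive.

Import Order.TTheory GRing.Theory Num.Theory.
Import numFieldNormedType.Exports.

Local Open Scope classical_set_scope.
Local Open Scope ring_scope.

Section subspaces.
Context {R : realType} {X : normedModType R}.

Definition linear_subspace (Y : set X) : Prop :=
  Y 0 /\ forall (a : R) (x y : X), Y x -> Y y -> Y (a *: x + y).

Definition separable_set (A : set X) : Prop :=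
  exists2 D : set X, countable D & D `<=` A /\ A `<=` closure D.

End subspaces.

Section strong_measurability.
Context d (T : measurableType d) (R : realType) (X : normedModType R).
Implicit Types f g : T -> X.

Definition simple_fun f : Prop :=
  finite_set (range f) /\ forall x, measurable (f @^-1` [set x]).

(* Strong measurability as a function with values in [A]: everywhere pointwise
   limit of [A]-valued simple functions.  Since L_p consists of classes modulo
   a.e. equality, asking for convergence a.e. only would give the same
   spaces. *)
Definition strongly_measurable (A : set X) f : Prop :=
  (forall t, A (f t)) /\
  exists s : nat -> T -> X,
    (forall n, simple_fun (s n) /\ forall t, A (s n t)) /\
    forall t, s ^~ t @ \oo --> f t.

Lemma simple_fun_cst x : simple_fun (cst x).
Proof.
split; first by apply: (sub_finite_set _ (finite_set1 x)) => _ [t _ <-].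
move=> y; have [<-|xy] := pselect (x = y).
  by rewrite (_ : _ @^-1` _ = setT)//; apply/seteqP; split.
by rewrite (_ : _ @^-1` _ = set0)//; apply/seteqP; split.
Qed.

Lemma simple_fun_comp2 (U : Type) (h : X -> X -> U) f g :
  simple_fun f -> simple_fun g ->
  finite_set (range (fun t => h (f t) (g t))) /\
  forall A, measurable ((fun t => h (f t) (g t)) @^-1` A).
Proof.
move=> [ff mf] [fg mg]; split.
  have := finite_image (fun z => h z.1 z.2) (finite_setX ff fg).
  apply: sub_finite_set => _ [t _ <-] /=.
  by exists (f t, g t) => //; split => /=; exists t.
move=> A.
pose I := (range f `*` range g) `&` [set z | A (h z.1 z.2)].
have -> : (fun t => h (f t) (g t)) @^-1` A =
    \bigcup_(z in I) (f @^-1` [set z.1] `&` g @^-1` [set z.2]).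
  apply/seteqP; split => [t At|t [[x y] [_ /= Axy] [/= -> ->]]//].
  exists (f t, g t) => //; split => //; split; by exists t.
apply: fin_bigcup_measurable; first exact/finite_setIl/finite_setX.
by move=> z _; apply: measurableI.
Qed.

Lemma strongly_measurable_cst x : strongly_measurable setT (cst x).
Proof.
split=> //; exists (fun=> cst x); split; last by move=> t; exact: cvg_cst.
by move=> n; split => //; exact: simple_fun_cst.
Qed.

Lemma strongly_measurableP (a : R) f g :
  strongly_measurable setT f -> strongly_measurable setT g ->
  strongly_measurable setT (fun t => a *: f t + g t).
Proof.
move=> [_ [s [ss sf]]] [_ [u [su ug]]]; split => //.
exists (fun n t => a *: s n t + u n t); split => [n|t].
  split=> //; have [sn _] := ss n; have [un _] := su n.
  have [h1 h2] := simple_fun_comp2 (fun x y => a *: x + y) sn un.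
  by split => // x; exact: h2.
by apply: cvgD => //; apply: cvgZr.
Qed.

Lemma strongly_measurable_norm A f : strongly_measurable A f ->
  measurable_fun setT (fun t => `|f t|).
Proof.
move=> [_ [s [ss sf]]].
apply: (@measurable_fun_cvg _ _ _ _ (fun n t => `|s n t|)) => //.
  move=> n; have [sn _] := ss n => _ B mB; rewrite setTI.
  exact: (simple_fun_comp2 (fun x _ => `|x|) sn sn).2.
by move=> t _; exact: cvg_norm.
Qed.

End strong_measurability.

Section Bochner_norm.
Context d (T : measurableType d) (R : realType).
Variables (mu : {measure set T -> \bar R}) (p : \bar R).

Lemma le_Lnorm_ae (f g : T -> R) : (1 <= p)%E ->
  measurable_fun setT f -> measurable_fun setT g ->
  (\forall t \ae mu, `|f t| <= `|g t|) ->
  ('N[mu]_p[EFin \o f] <= 'N[mu]_p[EFin \o g])%E.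
Proof.
rewrite unlock; case: p => [r r1|_|//] mf mg fg; last first.
  case: ifPn => // mu0; apply: le_ess_sup.
  by apply: filterS fg => t /=; rewrite lee_fin.
have r0 : 0 < r by rewrite (lt_le_trans ltr01).
have mpow (h : T -> R) : measurable_fun setT h ->
    measurable_fun setT (fun t => (`|(h t)%:E| `^ r)%E).
  move=> mh; apply: (measurableT_comp (measurable_poweR _)) => //.
  by apply: measurableT_comp => //; exact/measurable_EFinP.
apply: gt0_ler_poweR.
- by rewrite invr_ge0 ltW.
- by rewrite in_itv /= leey andbT; apply: integral_ge0 => t _; rewrite lee_fin powR_ge0.
- by rewrite in_itv /= leey andbT; apply: integral_ge0 => t _; rewrite lee_fin powR_ge0.
- apply: ae_ge0_le_integral => //.
  + by move=> t _; exact: poweR_ge0.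
  + exact: mpow.
  + by move=> t _; exact: poweR_ge0.
  + exact: mpow.
  + apply: filterS fg => t fg _ /=.
    by rewrite lee_fin ge0_ler_powR ?nnegrE// ltW.
Qed.

Variable X : normedModType R.
Implicit Types f g : T -> X.

Definition bochner_norm f : \bar R := Lnorm mu p (EFin \o (fun t => `|f t|)).

Lemma bochner_norm_ge0 f : (0 <= bochner_norm f)%E.
Proof. exact: Lnorm_ge0. Qed.

Hypothesis p1 : (1 <= p)%E.

Lemma eq_bochner_norm_ae f g :
  strongly_measurable setT f -> strongly_measurable setT g ->
  (\forall t \ae mu, f t = g t) -> bochner_norm f = bochner_norm g.
Proof.
move=> /strongly_measurable_norm mf /strongly_measurable_norm mg fg.
apply/eqP; rewrite eq_le; apply/andP; split; apply: le_Lnorm_ae => //;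
  by apply: filterS fg => t /= ->.
Qed.

Lemma bochner_normD f g :
  strongly_measurable setT f -> strongly_measurable setT g ->
  (bochner_norm (f \+ g)%R <= bochner_norm f + bochner_norm g)%E.
Proof.
move=> mf mg; have nf := strongly_measurable_norm mf.
have ng := strongly_measurable_norm mg.
have nfg := strongly_measurable_norm (strongly_measurableP 1 mf mg).
have mN := @eminkowski _ _ _ mu _ _ _ nf ng p1.
apply: le_trans mN; apply: le_Lnorm_ae => //.
- by move: nfg; under eq_fun do rewrite scale1r.
- exact: measurable_funD.
- by apply: aeW => t /=; rewrite normr_id ger0_norm ?addr_ge0// ler_normD.
Qed.

Lemma bochner_normZ f (a : R) : strongly_measurable setT f ->
  (bochner_norm f < +oo)%E ->
  bochner_norm (fun t => a *: f t) = (`|a|%:E * bochner_norm f)%E.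
Proof.
move=> mf ff; have nf : (fun t => `|f t|) \in Lfun mu p.
  rewrite inE; apply/andP; split; rewrite inE//=.
  exact: (strongly_measurable_norm mf).
have := LnormZ (Lfun_Sub p1 nf) `|a|; rewrite normr_id => <-.
by apply: eq_Lnorm => t /=; rewrite normrZ.
Qed.

Lemma bochner_norm_eq0 f : strongly_measurable setT f ->
  bochner_norm f = 0%E -> \forall t \ae mu, f t = 0.
Proof.
move=> mf /Lnorm_eq0_eq0 f0.
have : measurable_fun setT (fun t => `|f t|%:E).
  by apply/measurable_EFinP; exact: strongly_measurable_norm mf.
move=> /f0 /(_ (lt_le_trans lte01 p1)); apply: filterS => t /(_ I) /= [].
exact: normr0_eq0.
Qed.

End Bochner_norm.

Section Bochner_function.
Context d (T : measurableType d) (R : realType).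
Variables (mu : {measure set T -> \bar R}) (X : normedModType R).
Variables (p : \bar R) (p1 : (1 <= p)%E).

(* The unused argument [1 <= p] lets the submodule structure of this predicate
   be inferred. *)
Definition bochner_pred of (1 <= p)%E : {pred T -> X} :=
  mem [set f | strongly_measurable setT f /\ (bochner_norm mu p f < +oo)%E].

Lemma bochner_predP f : f \in bochner_pred p1 <->
  strongly_measurable setT f /\ (bochner_norm mu p f < +oo)%E.
Proof. by rewrite inE. Qed.

Lemma bochner_submod_closed : submod_closed (bochner_pred p1).
Proof.
split.
  apply/bochner_predP; split; first exact: strongly_measurable_cst.
  rewrite /bochner_norm (_ : _ \o _ = cst 0%E) ?Lnorm0//.
    by rewrite gt_eqF// (lt_le_trans _ p1).
  by apply/funext => t /=; rewrite normr0.
move=> a f g /bochner_predP[mf ff] /bochner_predP[mg fg].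
apply/bochner_predP; split; first exact: strongly_measurableP.
have maf : strongly_measurable setT (fun t => a *: f t).
  have := strongly_measurableP a mf (strongly_measurable_cst T 0).
  by under eq_fun do rewrite addr0.
apply: le_lt_trans (bochner_normD mu p1 maf mg) _.
rewrite lte_add_pinfty// bochner_normZ//.
by rewrite lte_mul_pinfty.
Qed.

HB.instance Definition _ :=
  GRing.isSubmodClosed.Build R (T -> X) (bochner_pred p1) bochner_submod_closed.

Record bochner_fun := BochnerFun {
  bochner_val :> T -> X ;
  _ : bochner_val \in bochner_pred p1 }.

HB.instance Definition _ := [isSub for bochner_val].
HB.instance Definition _ := [Choice of bochner_fun by <:].
HB.instance Definition _ := [SubChoice_isSubLmodule of bochner_fun by <:].

Lemma bochner_funP (f : bochner_fun) : strongly_measurable setT f.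
Proof. by case: f => f /= /bochner_predP[]. Qed.

Lemma bochner_fun_lty (f : bochner_fun) : (bochner_norm mu p f < +oo)%E.
Proof. by case: f => f /= /bochner_predP[]. Qed.

Definition bochner_equiv (f g : bochner_fun) : bool :=
  `[< \forall t \ae mu, f t = g t >].

Let bochner_equiv_refl : reflexive bochner_equiv.
Proof. by move=> f; apply/asboolP/aeW. Qed.

Let bochner_equiv_sym : symmetric bochner_equiv.
Proof.
by move=> f g; apply/asboolP/asboolP; apply: filterS => t ->.
Qed.

Let bochner_equiv_trans : transitive bochner_equiv.
Proof.
move=> g f h /asboolP fg /asboolP gh; apply/asboolP.
by apply: filterS2 fg gh => t -> ->.
Qed.

Canonical bochner_equiv_equivRel := EquivRel bochner_equiv
  bochner_equiv_refl bochner_equiv_sym bochner_equiv_trans.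

Local Open Scope quotient_scope.

Definition bochner_Lp : Type := {eq_quot bochner_equiv}.
HB.instance Definition _ := Choice.on bochner_Lp.
HB.instance Definition _ := EqQuotient.on bochner_Lp.

Definition Lp_class (f : bochner_fun) : bochner_Lp := \pi_bochner_Lp f.

Lemma Lp_class_eq f g :
  Lp_class f = Lp_class g <-> \forall t \ae mu, f t = g t.
Proof.
by split=> [/eqP|fg]; [rewrite eqmodE => /asboolP|apply/eqP; rewrite eqmodE; apply/asboolP].
Qed.

Lemma Lp_classK (u : bochner_Lp) : Lp_class (repr u) = u.
Proof. exact: reprK. Qed.

Lemma Lp_class_repr f : \forall t \ae mu, repr (Lp_class f) t = f t.
Proof. by apply/Lp_class_eq; rewrite Lp_classK. Qed.

Let zero : bochner_Lp := Lp_class 0.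
Let opp (u : bochner_Lp) : bochner_Lp := Lp_class (- repr u).
Let add (u v : bochner_Lp) : bochner_Lp := Lp_class (repr u + repr v).
Let scale (a : R) (u : bochner_Lp) : bochner_Lp := Lp_class (a *: repr u).
Let norm (u : bochner_Lp) : R := fine (bochner_norm mu p (repr u)).

Let oppE f : opp (Lp_class f) = Lp_class (- f).
Proof.
apply/Lp_class_eq; apply: filterS (Lp_class_repr f) => t /= ft.
by rewrite /= !fctE ft.
Qed.

Let addE f g : add (Lp_class f) (Lp_class g) = Lp_class (f + g).
Proof.
apply/Lp_class_eq; apply: filterS2 (Lp_class_repr f) (Lp_class_repr g).
by move=> t ft gt; rewrite /= !fctE ft gt.
Qed.

Let scaleE a f : scale a (Lp_class f) = Lp_class (a *: f).
Proof.
apply/Lp_class_eq; apply: filterS (Lp_class_repr f) => t /= ft.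
by rewrite /= !fctE ft.
Qed.

Let LpW (P : bochner_Lp -> Prop) : (forall f, P (Lp_class f)) -> forall u, P u.
Proof. by move=> Pf u; rewrite -[u]Lp_classK. Qed.

Let addA : associative add.
Proof.
elim/LpW => f; elim/LpW => g; elim/LpW => h.
by rewrite !addE addrA.
Qed.

Let addC : commutative add.
Proof. by elim/LpW => f; elim/LpW => g; rewrite !addE addrC. Qed.

Let add0 : left_id zero add.
Proof. by elim/LpW => f; rewrite addE add0r. Qed.

Let addN : left_inverse zero opp add.
Proof. by elim/LpW => f; rewrite oppE addE addNr. Qed.

HB.instance Definition _ := GRing.isZmodule.Build bochner_Lp addA addC add0 addN.

Let scaleA a b u : scale a (scale b u) = scale (a * b) u.
Proof. by elim/LpW: u => f; rewrite !scaleE scalerA. Qed.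

Let scale1 : left_id 1 scale.
Proof. by elim/LpW => f; rewrite scaleE scale1r. Qed.

Let scaleDr : right_distributive scale add.
Proof.
by move=> a; elim/LpW => f; elim/LpW => g; rewrite !(addE, scaleE) scalerDr.
Qed.

Let scaleDl u : {morph scale^~ u : a b / a + b >-> add a b}.
Proof. by elim/LpW: u => f a b; rewrite !(addE, scaleE) scalerDl. Qed.

HB.instance Definition _ := GRing.Zmodule_isLmodule.Build R bochner_Lp
  scaleA scale1 scaleDr scaleDl.

Let normE f : (norm (Lp_class f))%:E = bochner_norm mu p f.
Proof.
rewrite /norm fineK.
  apply: eq_bochner_norm_ae => //; [exact: bochner_funP..|].
  exact: Lp_class_repr.
by rewrite ge0_fin_numE ?bochner_norm_ge0// bochner_fun_lty.
Qed.

Let normD (u v : bochner_Lp) : norm (u + v) <= norm u + norm v.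
Proof.
elim/LpW: u => f; elim/LpW: v => g.
rewrite -lee_fin EFinD [_ + _]addE !normE.
by apply: bochner_normD => //; exact: bochner_funP.
Qed.

Let normZ a (u : bochner_Lp) : norm (a *: u) = `|a| * norm u.
Proof.
elim/LpW: u => f; apply: EFin_inj; rewrite EFinM [_ *: _]scaleE !normE.
by apply: bochner_normZ => //; [exact: bochner_funP|exact: bochner_fun_lty].
Qed.

Let norm0 (u : bochner_Lp) : norm u = 0 -> u = 0.
Proof.
elim/LpW: u => f nf; apply/Lp_class_eq.
apply: (bochner_norm_eq0 p1 (bochner_funP f)).
by rewrite -normE nf.
Qed.

HB.instance Definition _ := Lmodule_isNormed.Build R bochner_Lp
  normD normZ norm0.

Lemma Lp_norm_class f : (`|Lp_class f|)%:E = bochner_norm mu p f.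
Proof. exact: normE. Qed.

Lemma Lp_classD f g : Lp_class (f + g) = Lp_class f + Lp_class g.
Proof. by rewrite [RHS]addE. Qed.

Lemma Lp_classN f : Lp_class (- f) = - Lp_class f.
Proof. by rewrite [RHS]oppE. Qed.

Lemma Lp_classZ a f : Lp_class (a *: f) = a *: Lp_class f.
Proof. by rewrite [RHS]scaleE. Qed.

(* The copy of L_p(Y) inside L_p(X): classes having a representative that is
   strongly measurable as a Y-valued function. *)
Definition Lp_sub (Y : set X) : set bochner_Lp :=
  [set u | exists2 f, u = Lp_class f & strongly_measurable Y f].

End Bochner_function.

Arguments bochner_Lp {d T R} mu X {p} p1.
Arguments Lp_sub {d T R} mu {X p} p1 Y.

Section center_properties.
Context {R : realType} {Z : normedModType R}.

Definition inf_attained (W : set Z) (F : Z -> R) : Prop :=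
  exists2 w, W w & F w = inf [set F v | v in W].

(* All terms are nonnegative, so the default value 0 does not affect the
   maximum. *)
Definition restricted_weighted_Chebyshev_center_property (W : set Z) : Prop :=
  forall (n : nat) (z : 'I_n -> Z) (rho : 'I_n -> R), (0 < n)%N ->
    (forall i, 0 <= rho i) ->
    inf_attained W (fun w => \big[Num.max/0]_(i < n) (rho i * `|w - z i|)).

Definition F_p (p : R) (n : nat) (a : 'I_n -> R) : R :=
  (\sum_(i < n) `|a i| `^ p) `^ p^-1.

Definition restricted_Fp_center_property (p : R) (W : set Z) : Prop :=
  forall (n : nat) (z : 'I_n -> Z), (0 < n)%N ->
    inf_attained W (fun w => F_p p (fun i => `|w - z i|)).

End center_properties.

(* Main.v *)
Require Import Defs.
From mathcomp Require Import all_boot all_order all_algebra.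
From mathcomp Require Import all_classical all_reals all_analysis.
From mathcomp Require Import ess_sup_inf measurable_realfun.
Set Implicit Arguments.
Unset Strict Implicit.
Unset Printing Implicit Defensive.
Import Order.TTheory GRing.Theory Num.Theory.
Import numFieldNormedType.Exports.
Local Open Scope classical_set_scope.
Local Open Scope ring_scope.

(** Both equivalences compare the problem in L_p with the family of problems
    that it poses at the points t.

    From L_p to X, take the constant functions with values z_i.  A center f of
    these in L_p(Y) is compared with the constant functions y, for y in Y.
    For finite p, the p-th power of the cost is the integral of
    [pow_sum p (`|f t - z_i|)], and some value of a function is at most its
    average ([exists_le_average]), so some f t is a center.  For p = oo almost
    every value f t is one.

    From X to L_p, represent the given classes by functions z_i.  For each t
    the values z_i(t) have a center in Y; if one can be chosen for each t so
    that the result w is strongly measurable, then w is in L_p(Y), since its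
    norm is dominated by a multiple of the sum of the `|z_i t|
    ([bochner_dominated]), and it is a center because the cost in L_p is a
    monotone function of the pointwise costs.  (When all weights vanish there
    is no such bound, but then every element of L_oo(Y) is a center.)

    All the work is in the measurable choice ([measurable_minimizer]): given
    phi t y, measurable in t, continuous in y, with a minimum over Y for each
    t, there is a strongly measurable w with w t a minimizer for almost every
    t.  The set of t with a minimizer in a given ball is a projection, and need
    not be measurable.  This is circumvented as follows.  Let D be a dense
    sequence in Y.  The sets of t with a minimizer in the union of the first n
    balls of radius 1/(j+1) around points of D increase to the whole space, and
    outer measure is continuous along increasing unions of arbitrary sets
    ([thick_bigcup]); so for every c < mu(T) there is a choice of finitely many
    balls at each scale j such that, whatever the number of scales, the
    set of t with a minimizer inside all these unions of balls has outer measure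
    larger than c.  That set is contained in the set of t with a
    1/(m+1)-minimizer among the points of D in the same unions, which is
    measurable; the intersection of these over m has measure at least c.  For t
    in it, near-minimizers of all precisions lie in one totally bounded set, and
    Koenig's lemma picks, measurably, one ball at each scale
    that still contains near-minimizers of all precisions ([live_konig]).  The
    centers of these balls are simple functions of t that converge to a
    minimizer.  Letting c tend to mu(T) and glueing yields w. *)

(** * Maps with finitely many values *)

Section simple_maps.
Context d (T : measurableType d).
Implicit Types S U : Type.

(** The same notion as [simple_fun], for values in an arbitrary type: the
    selection below manipulates measurable choices of indices and of sets. *)
Definition simple_map S (f : T -> S) : Prop :=
  finite_set (range f) /\ forall x, measurable (f @^-1` [set x]).

Lemma simple_map_cst S (x : S) : simple_map (fun=> x).
Proof.
split; first by apply: (sub_finite_set _ (finite_set1 x)) => _ [t _ <-].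
move=> y; have [<-|xy] := pselect (x = y).
  by rewrite (_ : _ @^-1` _ = setT)//; apply/seteqP; split.
by rewrite (_ : _ @^-1` _ = set0)//; apply/seteqP; split.
Qed.

(** A choice depending on a previous choice stays simple, because the previous
    one takes finitely many values; this lets recursively defined choices be
    handled one step at a time. *)
Lemma simple_map_bind S U (f : T -> S) (g : S -> T -> U) :
  simple_map f -> (forall s, simple_map (g s)) ->
  simple_map (fun t => g (f t) t).
Proof.
move=> sf sg; have [ff mf] := sf; split.
  apply: (@sub_finite_set _ _ (\bigcup_(s in range f) range (g s))).
    by move=> _ [t _ <-]; exists (f t) => /=; exists t.
  by apply: bigcup_finite => // s _; case: (sg s).
move=> x.
have -> : (fun t => g (f t) t) @^-1` [set x] =
    \bigcup_(s in range f) (f @^-1` [set s] `&` g s @^-1` [set x]).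
  apply/seteqP; split => [t /= gx|t [s _ [/= -> ]]//].
  by exists (f t) => //; exists t.
apply: fin_bigcup_measurable => // s _; apply: measurableI; first exact: mf.
by case: (sg s).
Qed.

Lemma simple_map_comp S U (h : S -> U) (f : T -> S) :
  simple_map f -> simple_map (h \o f).
Proof.
move=> sf; apply: (simple_map_bind (g := fun s _ => h s) sf) => s.
exact: simple_map_cst.
Qed.

Lemma simple_map_if S (B : set T) (f g : T -> S) : measurable B ->
  simple_map f -> simple_map g ->
  simple_map (fun t => if `[< B t >] then f t else g t).
Proof.
move=> mB sf sg.
apply: (@simple_map_bind _ _ (fun t => `[< B t >])
  (fun b t => if b then f t else g t)) => [|[]//].
split; first exact: finite_finset.
move=> [].
  rewrite (_ : _ @^-1` _ = B)//; apply/seteqP.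
  by split => t /= /asboolP.
rewrite (_ : _ @^-1` _ = ~` B); first exact: measurableC.
by apply/seteqP; split => t /=; [move=> /negbT/asboolPn|move=> /asboolF].
Qed.

(** The least [n <= N] with [A n t], and [N] when there is none; the recursion
    makes it an iterated case distinction, hence simple. *)
Fixpoint first_index (A : nat -> set T) (N : nat) (t : T) : nat :=
  if N is N'.+1 then
    if `[< A (first_index A N' t) t >] then first_index A N' t else N
  else 0.

Lemma first_index_simple (A : nat -> set T) N :
  (forall n, measurable (A n)) -> simple_map (first_index A N).
Proof.
move=> mA; elim: N => [|N IH] /=; first exact: simple_map_cst.
apply: (simple_map_bind
  (g := fun k t => if `[< A k t >] then k else N.+1) IH) => k.
by apply: simple_map_if => //; exact: simple_map_cst.
Qed.

Lemma first_indexP A N t k :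
  (k <= N)%N -> A k t -> A (first_index A N t) t.
Proof.
elim: N => [|N IH] /=; first by rewrite leqn0 => /eqP ->.
case: asboolP => // nA; rewrite leq_eqVlt => /orP[/eqP -> //|kN Ak].
by case: nA; exact: IH.
Qed.

Lemma first_index_stable A N M t :
  (N <= M)%N -> A (first_index A N t) t ->
  first_index A M t = first_index A N t.
Proof.
move=> NM AN; elim: M NM => [|M IH]; first by rewrite leqn0 => /eqP ->.
rewrite leq_eqVlt => /orP[/eqP -> //|NM] /=.
by rewrite IH//; case: asboolP.
Qed.

End simple_maps.

(** * Glueing and outer measure *)

Section glueing.
Context d (T : measurableType d) (R : realType) (X : normedModType R).

(** Approximate by using, at stage j, the least index at most j whose set
    contains t; this index is simple and eventually stationary for each t. *)
Lemma strongly_measurable_glue (Y : set X) (A : nat -> set T)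
    (w : nat -> T -> X) :
  (forall n, measurable (A n)) -> (forall t, exists n, A n t) ->
  (forall n, strongly_measurable Y (w n)) ->
  exists2 v, strongly_measurable Y v & forall t, exists2 n, A n t & v t = w n t.
Proof.
move=> mA /choice[N AN] mw.
have /choice[s sP] : forall n, exists s : nat -> T -> X,
    (forall j, simple_fun (s j) /\ forall t, Y (s j t)) /\
    forall t, s ^~ t @ \oo --> w n t by move=> n; case: (mw n).
pose k t := first_index A (N t) t.
have Ak t : A (k t) t by exact: first_indexP (leqnn _) (AN t).
exists (fun t => w (k t) t); last by move=> t; exists (k t).
split; first by move=> t; case: (mw (k t)).
exists (fun j t => s (first_index A j t) j t); split.
  move=> j; split; last by move=> t; case: (sP (first_index A j t)) => /(_ j)[].
  apply: (simple_map_bind (g := fun n => s n j)).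
    exact: first_index_simple.
  by move=> n; case: (sP n) => /(_ j)[].
move=> t; have [_ /(_ t)] := sP (k t).
apply: cvg_trans; apply: near_eq_cvg; exists (N t) => // j /= Nj.
by rewrite (first_index_stable Nj (Ak t)).
Qed.

End glueing.

Section thickness.
Context d (T : measurableType d) (R : realType).
Variable mu : {measure set T -> \bar R}.

(** The outer measure of [A] is larger than [c], in a form in which the
    infimum over measurable supersets need not be taken. *)
Definition thick (c : \bar R) (A : set T) : Prop :=
  forall B, measurable B -> A `<=` B -> (c < mu B)%E.

(** Continuity from below of the outer measure. If measurable supersets [B n]
    of the [A n] all had measure at most [c], so would the increasing sets
    [\bigcap_m B (n + m)], which still contain the [A n], and hence also their
    union. *)
Lemma thick_bigcup c (A : nat -> set T) :
  (forall n m, (n <= m)%N -> A n `<=` A m) ->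
  thick c (\bigcup_n A n) -> exists n, thick c (A n).
Proof.
move=> ndA cA; apply: contrapT => /forallNP nA.
have /choice[B BP] n : exists B, [/\ measurable B, A n `<=` B & (mu B <= c)%E].
  apply: contrapT => nB; apply: (nA n) => B mB AB; rewrite ltNge.
  by apply/negP => Bc; apply: nB; exists B.
pose C n := \bigcap_m B (n + m)%N.
have mC n : measurable (C n).
  by apply: bigcapT_measurable => m; have [] := BP (n + m)%N.
have ndC : {homo C : n m / (n <= m)%N >-> (n <= m)%O}.
  move=> n m nm; apply/subsetPset => t Ct i _.
  by have := Ct (m - n + i)%N I; rewrite addnA subnKC.
have mCU : measurable (\bigcup_n C n) by exact: bigcup_measurable.
have AC : \bigcup_n A n `<=` \bigcup_n C n.
  move=> t [n _ At]; exists n => // m _.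
  by have [_ AB _] := BP (n + m)%N; apply/AB/(ndA _ _ _ _ At)/leq_addr.
have := cA _ mCU AC; apply/negP; rewrite -leNgt.
have cvC := @nondecreasing_cvg_mu _ _ _ mu _ mC mCU ndC.
rewrite -(cvg_lim _ cvC)//; apply: lime_le; first by apply/cvg_ex; eexists; exact: cvC.
near=> n => /=; have [mB _] := BP (n + 0)%N; apply: le_trans.
by apply: le_measure; rewrite ?inE// => t /(_ 0%N I).
Unshelve. all: by end_near.
Qed.

End thickness.

(** * Measurable selection of minimizers *)

Section selection.
Context d (T : measurableType d) (R : realType) (X : completeNormedModType R).
Variable mu : {finite_measure set T -> \bar R}.
Variables (Y : set X) (phi : T -> X -> R) (D : nat -> X).
Hypothesis Y_closed : closed Y.
Hypothesis YD : forall k, Y (D k).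
Hypothesis D_dense : Y `<=` closure (range D).
Hypothesis phi_meas : forall x, measurable_fun setT (phi ^~ x).
Hypothesis phi_cont : forall t, continuous (phi t).

Definition minimizes t y := Y y /\ forall y', Y y' -> phi t y <= phi t y'.

Let r (n : nat) : R := n.+1%:R^-1.

Let r_gt0 n : 0 < r n. Proof. by rewrite invr_gt0. Qed.

Let r_le n m : (n <= m)%N -> r m <= r n.
Proof. by move=> nm; rewrite lef_pV2 ?posrE// ler_nat. Qed.

Let r_small (e : R) : 0 < e -> exists n, r n < e.
Proof.
move=> e0; have [n _ /(_ n (leqnn n))] := near_infty_natSinv_lt (PosNum e0).
by exists n.
Qed.

(** Only points of the dense sequence are compared, so that this is a countable
    condition, measurable in [t]. *)
Definition near_min m l t := forall k, phi t (D l) <= phi t (D k) + r m.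

Lemma measurable_near_min m l : measurable (near_min m l).
Proof.
rewrite (_ : near_min m l =
    \bigcap_k (setT `&` [set t | phi t (D l) <= phi t (D k) + r m])).
  apply: bigcapT_measurable => k; apply: measurable_fun_le => //.
  exact: measurable_funD.
apply/seteqP; split => t H k; first by move=> _; split => //; exact: H.
by have [] := H k I.
Qed.

Lemma near_min_le m m' l t : (m <= m')%N -> near_min m' l t -> near_min m l t.
Proof. by move=> mm' H k; rewrite (le_trans (H k))// lerD2l r_le. Qed.

Lemma dense_open_near (V : set X) t y m : open V -> V y -> minimizes t y ->
  exists l, V (D l) /\ near_min m l t.
Proof.
move=> oV Vy [Yy ymin].
have nV : nbhs y (V `&` [set x | phi t x < phi t y + r m]).
  apply: filterI; first exact: open_nbhs_nbhs.
  apply: (cvgr_lt (phi t y)); first exact: phi_cont.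
  by rewrite ltrDl.
have [_ [[l _ <-] [VD /= Dy]]] := D_dense Yy nV.
exists l; split => // k; rewrite (le_trans (ltW Dy))// lerD2r.
exact: ymin.
Qed.

Lemma minimizes_lim t (x : nat -> nat) y :
  D \o x @ \oo --> y -> (forall m, near_min m (x m) t) -> minimizes t y.
Proof.
move=> xy xmin; split.
  by apply: (closed_cvg Y) xy => //; apply: nearW => n; exact: YD.
have yD k : phi t y <= phi t (D k).
  apply/ler_addgt0Pr => e e0; have [n rn] := r_small e0.
  have cv : phi t \o (D \o x) @ \oo --> phi t y.
    by apply: continuous_cvg xy; exact: phi_cont.
  rewrite -(cvg_lim _ cv)//; apply: limr_le; first by apply/cvg_ex; eexists; exact: cv.
  exists n => // m /= nm; rewrite (le_trans (xmin m k))// lerD2l.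
  by rewrite (le_trans (r_le nm))// ltW.
move=> z Yz; apply/ler_addgt0Pr => e e0.
have nz : nbhs z [set x | phi t x < phi t z + e].
  by apply: (cvgr_lt (phi t z)); [exact: phi_cont|rewrite ltrDl].
have [_ [[l _ <-] /= Dz]] := D_dense Yz nz.
by rewrite (le_trans (yD l))// ltW.
Qed.

Definition cover j n : set X :=
  \bigcup_(k in [set k | (k <= n)%N]) ball (D k) (r j).

Lemma open_cover j n : open (cover j n).
Proof. by apply: bigcup_open => k _; exact: ball_open. Qed.

Definition solvable (V : set X) : set T :=
  [set t | exists2 y, V y & minimizes t y].

(** Since the balls around all the points of [D] cover [Y], a finite number of
    them captures minimizers on a set of the same outer measure bound. *)
Lemma solvable_cover c j V : thick mu c (solvable V) ->
  exists n, thick mu c (solvable (V `&` cover j n)).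
Proof.
move=> cV; apply: thick_bigcup.
  move=> n m nm t [y [Vy [k kn Dy]] ymin]; exists y => //; split => //.
  by exists k => //=; exact: leq_trans nm.
move=> B mB UB; apply: cV => // t [y Vy ymin]; apply: UB.
have [Yy _] := ymin.
have [_ [[k _ <-]]] := D_dense Yy (nbhsx_ballx y _ (r_gt0 j)).
move=> /ball_sym Dy; exists k => //; exists y => //; split => //.
by exists k => //=.
Qed.

Section scheme.
(* [N j W] is the number of balls of radius [r j] kept inside the region [W]
   reached at stage [j]. *)
Variables (c : R) (N : nat -> set X -> nat).
Hypothesis NP : forall j V, thick mu c%:E (solvable V) ->
  thick mu c%:E (solvable (V `&` cover j (N j V))).
Hypothesis c_thick : thick mu c%:E (solvable setT).

Fixpoint V j : set X :=
  if j is i.+1 then V i `&` cover i (N i (V i)) else setT.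

Lemma open_V j : open (V j).
Proof. by elim: j => [|j IH] /=; [exact: openT|apply: openI => //; exact: open_cover]. Qed.

Lemma thick_V j : thick mu c%:E (solvable (V j)).
Proof. by elim: j => //= j IH; exact: NP. Qed.

Lemma V_le i j : (i <= j)%N -> V j `<=` V i.
Proof.
elim: j => [|j IH]; first by rewrite leqn0 => /eqP ->.
by rewrite leq_eqVlt => /orP[/eqP -> //|ij] x [] /(IH ij).
Qed.

(** The measurable substitute for the existence of a minimizer in the
    intersection of [U] with all the [V m]. Using a single [m] for the precision
    and for the number of scales makes the conditions decreasing in [m], which
    [live_konig] relies upon. *)
Definition live (U : set X) : set T :=
  [set t | forall m, exists l, [/\ U (D l), V m (D l) & near_min m l t]].

Lemma measurable_live U : measurable (live U).
Proof.
rewrite (_ : live U =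
   \bigcap_m \bigcup_(l in [set l | U (D l) /\ V m (D l)]) near_min m l).
  apply: bigcapT_measurable => m; apply: bigcup_measurable => l _.
  exact: measurable_near_min.
apply/seteqP; split => t /= H m.
  by move=> _; have [l []] := H m; exists l.
by have [l [Ul Vl] nl] := H m I; exists l.
Qed.

(** The [m]-th condition of [live setT] holds wherever there is a minimizer in
    the open set [V m], a set of outer measure larger than [c]. *)
Lemma live_large : (c%:E <= mu (live setT))%E.
Proof.
pose Q m := \bigcup_(l in [set l | V m (D l)]) near_min m l.
have mQ m : measurable (Q m).
  by apply: bigcup_measurable => l _; exact: measurable_near_min.
have liveE : live setT = \bigcap_m Q m.
  apply/seteqP; split => t /= H m.
    by move=> _; have [l [_ ? ?]] := H m; exists l.
  by have [l] := H m I; exists l.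
have niQ : {homo Q : n m / (n <= m)%N >-> (m <= n)%O}.
  move=> n m nm; apply/subsetPset => t [l Vl nl].
  by exists l; [exact: V_le Vl|exact: near_min_le nl].
have cQ m : (c%:E < mu (Q m))%E.
  apply: (thick_V (mQ m)) => t [y Vy ymin].
  have [l [Vl nl]] := dense_open_near m (open_V m) Vy ymin.
  by exists l.
have mQI : measurable (\bigcap_m Q m) by exact: bigcapT_measurable.
have Q0 : (mu (Q 0%N) < +oo)%E by rewrite ltey_eq fin_num_measure.
have cvQ := @nonincreasing_cvg_mu _ _ _ mu _ Q0 mQ mQI niQ.
rewrite liveE -(cvg_lim _ cvQ)//; apply: lime_ge.
  by apply/cvg_ex; eexists; exact: cvQ.
by apply: nearW => n; apply: ltW; exact: cQ.
Qed.

(** Pigeonhole: were each of the finitely many smaller regions to fail at some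
    precision, all of them would fail at a common precision beyond [j], at which
    [V] is already contained in the union of their balls. *)
Lemma live_konig U t j : live U t ->
  exists2 k, (k <= N j (V j))%N & live (U `&` ball (D k) (r j)) t.
Proof.
move=> Ut; apply: contrapT => nk.
have /filter_forall : forall k : 'I_(N j (V j)).+1, \forall m \near \oo,
    ~ exists l, [/\ (U `&` ball (D k) (r j)) (D l), V m (D l) & near_min m l t].
  move=> k; have /existsNP[m nm] : ~ live (U `&` ball (D k) (r j)) t.
    by move=> lk; apply: nk; exists k => //; rewrite -ltnS.
  exists m => // m' /= mm' [l [Ul Vl nl]]; apply: nm; exists l; split => //.
    exact: V_le Vl.
  exact: near_min_le nl.
case=> M _ HM.
have [l [Ul Vl nl]] := Ut (maxn M j.+1).
have [_ [k kN Dl]] := V_le (leq_maxr M j.+1) Vl.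
have := HM (maxn M j.+1) (leq_maxl _ _) (Ordinal (kN : (k < (N j (V j)).+1)%N)).
by apply; exists l.
Qed.

Definition next_center j U t : nat :=
  first_index (fun k => live (U `&` ball (D k) (r j))) (N j (V j)) t.

(** The region in which the minimizer for [t] is sought after [j] choices. *)
Fixpoint cell j t : set X :=
  if j is i.+1 then
    cell i t `&` ball (D (next_center i (cell i t) t)) (r i)
  else setT.

Definition center j t : X := D (next_center j (cell j t) t).

Lemma next_center_simple j U : simple_map (next_center j U).
Proof. by apply: first_index_simple => k; exact: measurable_live. Qed.

Lemma cell_simple j : simple_map (cell j).
Proof.
elim: j => [|j IH] /=; first exact: simple_map_cst.
apply: (simple_map_bind
  (g := fun U t => U `&` ball (D (next_center j U t)) (r j)) IH) => U.
apply: (simple_map_comp (fun k => U `&` ball (D k) (r j))).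
exact: next_center_simple.
Qed.

Lemma center_simple j : simple_map (center j).
Proof.
apply: (simple_map_bind (g := fun U t => D (next_center j U t)) (cell_simple j)).
by move=> U; apply: (simple_map_comp D); exact: next_center_simple.
Qed.

Lemma live_cell j t : live setT t -> live (cell j t) t.
Proof.
move=> t0; elim: j => //= j IH.
have [k kN Uk] := live_konig j IH.
exact: (@first_indexP _ _
  (fun k => live (cell j t `&` ball (D k) (r j))) _ _ _ kN Uk).
Qed.

Lemma cell_center i j t : (i < j)%N -> cell j t `<=` ball (center i t) (r i).
Proof.
elim: j => // j IH; rewrite ltnS leq_eqVlt => /orP[/eqP -> x []//|ij] x [].
by move=> /(IH ij).
Qed.

(** The centers form a Cauchy sequence because any two of the chosen balls meet;
    near-minimizers of increasing precision, taken in smaller and smaller balls,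
    follow the centers to the limit, which is therefore a minimizer. *)
Lemma cvg_center t : live setT t ->
  exists2 y, minimizes t y & center ^~ t @ \oo --> y.
Proof.
move=> t0.
have /choice[l lP] j : exists l, cell j.+1 t (D l) /\ near_min j l t.
  by have [l [? _ ?]] := live_cell j.+1 t0 j; exists l.
have lc i j : (i <= j)%N -> ball (center i t) (r i) (D (l j)).
  by move=> ij; have [Cl _] := lP j; exact: (cell_center _ Cl).
have /cvg_ex[/= y cy] : cvg (center ^~ t @ \oo).
  apply/cauchy_cvgP/cauchy_exP => e /= e0.
  have [j rj] := r_small (divr_gt0 e0 (ltr0n _ 2)).
  (* the point [D (l i)] lies in the balls chosen at stages [j] and [i] *)
  exists (center j t); exists j => // i /= ji.
  rewrite [e]splitr; apply: (@ball_triangle _ _ (D (l i))).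
    by apply: le_ball (lc _ _ ji); exact: ltW.
  apply/ball_sym; apply: le_ball (lc _ _ (leqnn i)).
  by rewrite (le_trans (r_le ji))// ltW.
exists y => //; apply: (@minimizes_lim _ l) => [|m]; last by case: (lP m).
apply/cvg_ballP => e e0.
have [j rj] := r_small (divr_gt0 e0 (ltr0n _ 2)).
move/cvg_ballP : cy => /(_ _ (divr_gt0 e0 (ltr0n _ 2))).
apply: filterS2 (nbhs_infty_ge j) => i /= ji yc.
rewrite [e]splitr; apply: ball_triangle yc _.
apply: le_ball (lc _ _ (leqnn i)).
by rewrite (le_trans (r_le ji))// ltW.
Qed.

Lemma selection_live : exists2 w, strongly_measurable Y w &
  forall t, live setT t -> minimizes t (w t).
Proof.
have mS := measurable_live setT.
have /choice[w wP] t : exists y, if `[< live setT t >] then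
    minimizes t y /\ center ^~ t @ \oo --> y else y = D 0.
  by case: asboolP => [/cvg_center[y]|_]; [exists y|exists (D 0)].
exists w; last by move=> t t0; have := wP t; rewrite asboolT// => -[].
split.
  by move=> t; have := wP t; case: ifP => _; [case=> -[]|move=> ->].
exists (fun j t => if `[< live setT t >] then center j t else D 0); split.
  move=> j; split; last by move=> t; case: ifP => _; exact: YD.
  exact: (simple_map_if mS (center_simple j) (simple_map_cst _ (D 0%N))).
by move=> t; have := wP t; case: ifP => _ => [[]//|->]; exact: cvg_cst.
Qed.

End scheme.

Lemma selection_up_to c : (c%:E < mu setT)%E ->
  (forall t, exists y, minimizes t y) ->
  exists w Q, [/\ strongly_measurable Y w, measurable Q, (c%:E <= mu Q)%E &
    forall t, Q t -> minimizes t (w t)].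
Proof.
move=> cT ex.
have /choice[N NP] (jV : nat * set X) : exists n,
    thick mu c%:E (solvable jV.2) ->
    thick mu c%:E (solvable (jV.2 `&` cover jV.1 n)).
  have [/(solvable_cover jV.1)[n nP]|nV] :=
    pselect (thick mu c%:E (solvable jV.2)); first by exists n.
  by exists 0%N.
have thickT : thick mu c%:E (solvable setT).
  move=> B mB TB; rewrite (_ : B = setT)//; apply/seteqP; split => // t _.
  by apply: TB; have [y ymin] := ex t; exists y.
pose N' j V := N (j, V).
have N'P j V : thick mu c%:E (solvable V) ->
    thick mu c%:E (solvable (V `&` cover j (N' j V))) by exact: (NP (j, V)).
have [w mw wP] := selection_live N'.
exists w, (live N' setT); split => //; first exact: measurable_live.
exact: live_large N'P thickT.
Qed.

(** The selections obtained up to measure [r n] cover almost everything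
    together; they are glued along the sets where they are valid. *)
Lemma measurable_minimizer : (forall t, exists y, minimizes t y) ->
  exists2 w, strongly_measurable Y w & \forall t \ae mu, minimizes t (w t).
Proof.
move=> ex.
have [a muT] : exists a, mu setT = a%:E.
  by exists (fine (mu setT)); rewrite fineK// fin_num_measure.
have /choice[w /choice[Q wQ]] n : exists w Q, [/\ strongly_measurable Y w,
    measurable Q, ((a - r n)%:E <= mu Q)%E &
    forall t, Q t -> minimizes t (w t)].
  by apply: selection_up_to => //; rewrite muT lte_fin ltrBlDr ltrDl.
(* adding the exceptional set to every [Q n] makes the [A n] cover the space *)
pose A n := Q n `|` ~` \bigcup_m Q m.
have mQU : measurable (\bigcup_m Q m).
  by apply: bigcup_measurable => m _; case: (wQ m).
have mA n : measurable (A n).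
  by apply: measurableU; [case: (wQ n)|exact: measurableC].
have AT t : exists n, A n t.
  by have [[n _ Qn]|nQ] := pselect ((\bigcup_m Q m) t); [exists n; left|exists 0%N; right].
have [v mv vP] := strongly_measurable_glue mA AT (fun n => let: And4 h _ _ _ := wQ n in h).
exists v => //; exists (~` \bigcup_m Q m); split.
- exact: measurableC.
- apply/eqP; rewrite eq_le measure_ge0 andbT; apply/lee_addgt0Pr => e e0.
  have [n rn] := r_small e0; rewrite add0e.
  have [_ mQn cQ _] := wQ n.
  rewrite -setTD measureD ?setTI//; last by rewrite ltey_eq fin_num_measure.
  rewrite leeBlDr ?fin_num_measure//.
  have QU : (mu (Q n) <= mu (\bigcup_m Q m))%E.
    by apply: le_measure; rewrite ?inE//; exact: bigcup_sup.
  have muU := fineK (fin_num_measure mu _ mQU).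
  have : (a%:E <= e%:E + (fine (mu (\bigcup_m Q m)))%:E)%E.
    have := le_trans cQ QU; rewrite -muU -EFinD !lee_fin lerBlDr => h.
    by rewrite (le_trans h)// addrC lerD2r ltW.
  by rewrite muU -muT.
- move=> t; apply: contra_notP => /contrapT tQ /=.
  have [n [Qn|//] ->] := vP t.
  by have [_ _ _] := wQ n; apply.
Qed.

End selection.

(** * Pointwise costs *)

Section preliminaries.
Context {R : realType}.

Lemma inf_attainedP (Z : normedModType R) (W : set Z) (F : Z -> R) :
  (forall w, 0 <= F w) ->
  inf_attained W F <-> exists2 w, W w & forall v, W v -> F w <= F v.
Proof.
move=> F0; have lbF : has_lbound [set F v | v in W] by exists 0 => _ [v _ <-].
split=> [[w Ww Fw]|[w Ww Fw]]; exists w => //.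
  by move=> v Wv; rewrite Fw; apply: ge_inf => //; exists v.
apply/eqP; rewrite eq_le; apply/andP; split.
  by apply: lb_le_inf => [|_ [v /Fw ? <-]//]; exists (F w), w.
by apply: ge_inf => //; exists w.
Qed.

Lemma separable_seq (X : normedModType R) (Y : set X) :
  Y !=set0 -> separable_set Y ->
  exists2 D : nat -> X, forall k, Y (D k) & Y `<=` closure (range D).
Proof.
move=> [y0 Yy0] [E /countable_injP[f finj] [EY YE]].
have /choice[D DP] k : exists x, Y x /\ forall x', E x' -> f x' = k -> x' = x.
  have [[x Ex fx]|nx] := pselect (exists2 x, E x & f x = k).
    exists x; split; first exact: EY.
    by move=> x' Ex' fx'; apply: finj; rewrite ?inE// fx' fx.
  by exists y0; split => // x' Ex' fx'; case: nx; exists x'.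
exists D; first by move=> k; case: (DP k).
apply: subset_trans YE _; apply: closureS => x Ex; exists (f x) => //.
by have [_ /(_ x Ex erefl)] := DP (f x).
Qed.

Lemma ler_powR_iff (p x y : R) : 0 < p -> 0 <= x -> 0 <= y ->
  (x `^ p <= y `^ p) = (x <= y).
Proof.
move=> p0 x0 y0; apply/idP/idP => [|xy]; last first.
  by apply: ge0_ler_powR => //; exact: ltW.
by rewrite !leNgt; apply: contra => yx; apply: gt0_ltr_powR.
Qed.

Lemma continuous_norm_powR (X : normedModType R) (p : R) : 0 < p ->
  continuous (fun x : X => `|x| `^ p).
Proof.
move=> p0 x; have [->|x0] := eqVneq x 0; last first.
  apply: (@cvg_comp _ _ _ (@Num.norm _ X) (@powR R ^~ p) _ (nbhs `|x|)).
    exact: norm_continuous.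
  have px : derivable (@powR R ^~ p) `|x| 1.
    by apply: derivable_powR; rewrite in_itv/= andbT normr_gt0.
  have := @differentiable_continuous _ _ _ _ _ ((derivable1_diffP _ _).1 px).
  by move=> pc; exact: pc.
rewrite /continuous_at normr0 powR0 ?gt_eqF//.
apply/cvgrPdist_lt => e e0; near=> y.
rewrite sub0r normrN ger0_norm ?powR_ge0//.
(* `|y| < e^(1/p) suffices *)
rewrite -[ltRHS]powRr1 ?ltW// -(mulVf (lt0r_neq0 p0)) powRrM.
apply: gt0_ltr_powR => //; rewrite ?nnegrE ?powR_ge0//.
near: y; apply: (@cvgr0_norm_lt _ _ _ _ _ id); first exact: cvg_id.
exact: powR_gt0.
Unshelve. all: by end_near.
Qed.

End preliminaries.

Section pow_sum.
Context {R : realType}.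

(** The p-th power of [F_p p]: it has the same minimizers, and its L_p version
    is an integral of its pointwise values. *)
Definition pow_sum (p : R) n (a : 'I_n -> R) : R := \sum_(i < n) `|a i| `^ p.

Lemma pow_sum_ge0 p n (a : 'I_n -> R) : 0 <= pow_sum p a.
Proof. by apply: sumr_ge0 => i _; exact: powR_ge0. Qed.

Lemma ler_Fp p n (a b : 'I_n -> R) : 0 < p ->
  (F_p p a <= F_p p b) = (pow_sum p a <= pow_sum p b).
Proof. by move=> p0; rewrite ler_powR_iff ?invr_gt0 ?pow_sum_ge0. Qed.

(** The constant [n] is cruder than the optimal [n] to the power [1/p], but it
    avoids roots: [n <= n `^ p] as [1 <= p]. *)
Lemma pow_sum_le p n (a : 'I_n -> R) s j : 1 <= p -> 0 <= s ->
  pow_sum p a <= pow_sum p (fun _ : 'I_n => s) -> `|a j| <= n%:R * s.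
Proof.
move=> p1 s0 h; have p0 := lt_le_trans ltr01 p1.
have n1 : 1 <= n%:R :> R by rewrite ler1n; case: n a j {h} => // ? [].
rewrite -(ler_powR_iff p0) ?mulr_ge0//.
apply: le_trans (_ : pow_sum p a <= _).
  by rewrite /pow_sum (bigD1 j)//= lerDl sumr_ge0// => i _; exact: powR_ge0.
apply: (le_trans h); rewrite /pow_sum sumr_const card_ord ger0_norm//.
rewrite -[leLHS]mulr_natl.
rewrite powRM// ler_wpM2r ?powR_ge0//.
by rewrite -[leLHS]powRr1 ?ler_powR.
Qed.

End pow_sum.

(** * Functions in L_p *)

Section strong_measurability_facts.
Context d (T : measurableType d) (R : realType) (X : normedModType R).
Implicit Types f g : T -> X.

Lemma sub_strongly_measurable (A B : set X) f :
  A `<=` B -> strongly_measurable A f -> strongly_measurable B f.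
Proof.
move=> AB [Af [s [ss sf]]]; split; first by move=> t; exact: AB.
by exists s; split => // n; have [? ?] := ss n; split => // t; exact: AB.
Qed.

Lemma strongly_measurableB f g :
  strongly_measurable setT f -> strongly_measurable setT g ->
  strongly_measurable setT (fun t => f t - g t).
Proof.
move=> mf mg; have := strongly_measurableP (-1) mg mf.
by under eq_fun do rewrite scaleN1r addrC.
Qed.

Lemma strongly_measurable_constant (A : set X) x :
  A x -> strongly_measurable A (fun _ : T => x).
Proof.
move=> Ax; split => //; exists (fun _ _ => x); split => [n|t].
  by split => //; exact: simple_fun_cst.
exact: cvg_cst.
Qed.

End strong_measurability_facts.

Section bochner_functions.
Context d (T : measurableType d) (R : realType) (X : normedModType R).
Variable mu : {finite_measure set T -> \bar R}.

(** Membership in L_p of the selected centers: the dominating function is a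
    linear combination of the norms of the [z i], and real L_p functions form a
    vector space. *)
Lemma bochner_dominated p (p1 : (1 <= p)%E) n (z : 'I_n -> bochner_fun mu X p1)
    (C : R) (w : T -> X) :
  strongly_measurable setT w ->
  (\forall t \ae mu, `|w t| <= C * \sum_(i < n) `|z i t|) ->
  w \in bochner_pred mu p1.
Proof.
move=> mw wz; apply/bochner_predP; split => //.
have [L0 LP] := Lfun_submod_closed mu p1.
have Lz i : (fun t => `|z i t|) \in Lfun mu p.
  rewrite inE; apply/andP; split; rewrite inE/=.
    exact: (strongly_measurable_norm (bochner_funP _)).
  exact: bochner_fun_lty.
pose h : T -> R := C *: (\sum_(i < n) (fun t => `|z i t|)).
have : h \in Lfun mu p.
  rewrite /h -[_ *: _]addr0; apply: (LP) => //.
  apply: (big_ind (fun g : T -> R => g \in Lfun mu p)) => // f g Lf Lg.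
  by rewrite -[f]scale1r; exact: LP.
rewrite inE => /andP[]; rewrite !inE/= => mh; apply: le_lt_trans.
apply: le_Lnorm_ae => //; first exact: strongly_measurable_norm mw.
apply: filterS wz => t wt; rewrite normr_id (le_trans wt)//.
rewrite (_ : h t = C * \sum_(i < n) `|z i t|) ?ler_norm//.
by rewrite /h -[(_ *: _) t]/(C * _) fct_sumE.
Qed.

Lemma Lp_norm_sub p (p1 : (1 <= p)%E) (f g : bochner_fun mu X p1) :
  (`|Lp_class f - Lp_class g|)%:E = bochner_norm mu p (fun t => f t - g t).
Proof. by rewrite -Lp_classN -Lp_classD Lp_norm_class. Qed.

Lemma measurable_norm_sub p (p1 : (1 <= p)%E) (f g : bochner_fun mu X p1) :
  measurable_fun setT (fun t => `|f t - g t|).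
Proof.
apply: strongly_measurable_norm; apply: strongly_measurableB;
  exact: bochner_funP.
Qed.

Lemma constant_bochner p (p1 : (1 <= p)%E) (x : X) :
  exists f : bochner_fun mu X p1, f = (fun=> x) :> (T -> X).
Proof.
have mx : strongly_measurable setT (fun _ : T => x).
  exact: strongly_measurable_constant.
suff mf : (fun=> x) \in bochner_pred mu p1 by exists (BochnerFun mf).
apply/bochner_predP; split => //; rewrite /bochner_norm.
case: p p1 => [q||] // _.
  by have := Lfun_cst mu `|x| q; rewrite inE => /andP[_]; rewrite inE.
rewrite unlock /Lnorm; case: ifPn => // _; apply: le_lt_trans (ltry `|x|).
by apply/ess_supP/aeW => t /=; rewrite lee_fin normr_id.
Qed.

Section finite_exponent.
Variables (p : R) (p1 : (1 <= p%:E)%E) (n : nat).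
Implicit Types (f g : bochner_fun mu X p1) (z : 'I_n -> bochner_fun mu X p1).

Let p_gt0 : 0 < p.
Proof. by rewrite (lt_le_trans ltr01)// -lee_fin. Qed.

Lemma measurable_pow_sum f z :
  measurable_fun setT (fun t => pow_sum p (fun i => `|f t - z i t|)).
Proof.
apply: measurable_sum => i.
apply: (measurableT_comp (measurable_powR p)).
by apply: measurableT_comp => //; exact: measurable_norm_sub.
Qed.

Lemma Lp_pow_sum f z :
  (pow_sum p (fun i => `|Lp_class f - Lp_class (z i)|))%:E =
  (\int[mu]_t (pow_sum p (fun i => `|f t - z i t|))%:E)%E.
Proof.
rewrite /pow_sum -sumEFin.
under [RHS]eq_integral => t _ do rewrite -sumEFin.
rewrite ge0_integral_sum//=; last first.
  move=> i; apply/measurable_EFinP.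
  apply: (measurableT_comp (measurable_powR p)).
  by apply: measurableT_comp => //; exact: measurable_norm_sub.
apply: eq_bigr => i _; rewrite -poweR_EFin normr_id Lp_norm_sub.
by rewrite poweR_Lnorm ?gt_eqF.
Qed.

End finite_exponent.

(** [mu_gt0] matters for [M < 0]: on a null space everything holds almost
    everywhere, whereas a norm is nonnegative. *)
Lemma Linfty_norm_sub_le (mu_gt0 : (0 < mu setT)%E)
    (f g : bochner_fun mu X (leey 1 : (1 <= +oo :> \bar R)%E)) (M : R) :
  `|Lp_class f - Lp_class g| <= M <-> \forall t \ae mu, `|f t - g t| <= M.
Proof.
rewrite -lee_fin Lp_norm_sub /bochner_norm unlock mu_gt0.
split=> [/ess_supP|fgM].
  by apply: filterS => t /=; rewrite lee_fin normr_id.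
by apply/ess_supP; apply: filterS fgM => t /=; rewrite lee_fin normr_id.
Qed.

(** Otherwise [g - a] would be positive everywhere with integral zero. *)
Lemma exists_le_average (g : T -> R) (a : R) : (0 < mu setT)%E ->
  measurable_fun setT g -> 0 <= a ->
  (\int[mu]_t (g t)%:E <= a%:E * mu setT)%E -> exists t, g t <= a.
Proof.
move=> mu0 mg a0 ga; apply: contrapT => /forallNP ng.
have ltg t : a < g t by rewrite ltNge; apply/negP/ng.
have mga : measurable_fun setT (fun t => (g t - a)%:E).
  by apply/measurable_EFinP; apply: measurable_funB.
have ga0 t : setT t -> (0 <= (g t - a)%:E)%E.
  by move=> _; rewrite lee_fin subr_ge0 ltW.
have int_ga : (\int[mu]_t (g t)%:E =
    a%:E * mu setT + \int[mu]_t (g t - a)%:E)%E.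
  rewrite -integral_cst// -ge0_integralD//.
  by apply: eq_integral => t _ /=; rewrite -EFinD addrC subrK.
have : (\int[mu]_t `|(g t - a)%:E| = 0)%E.
  under eq_integral => t _ do rewrite gee0_abs ?ga0//.
  apply/eqP; rewrite eq_le integral_ge0// andbT.
  have fa : (a%:E * mu setT)%E \is a fin_num by rewrite fin_numM// fin_num_measure.
  by rewrite -(leeD2lE _ _ fa) -int_ga adde0.
move=> /(ae_eq_integral_abs mu measurableT mga) ae0.
have := @ae_properfilter_algebraOfSetsType _ _ _ mu mu0.
move=> PF; have [t /(_ I) /= []] := filter_ex ae0.
by move=> /eqP; rewrite subr_eq0 gt_eqF.
Qed.

End bochner_functions.

(** * Centers *)

Section centers.
Context d (T : measurableType d) (R : realType) (X : completeNormedModType R).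
Variable mu : {finite_measure set T -> \bar R}.
Hypothesis mu_gt0 : (0 < mu setT)%E.
Variable Y : set X.
Hypotheses (Y0 : Y 0) (Y_closed : closed Y) (Y_sep : separable_set Y).

Lemma ae_minimizer (phi : T -> X -> R) :
  (forall x, measurable_fun setT (phi ^~ x)) ->
  (forall t, continuous (phi t)) ->
  (forall t, exists2 y, Y y & forall y', Y y' -> phi t y <= phi t y') ->
  exists2 w, strongly_measurable Y w &
    \forall t \ae mu, forall y, Y y -> phi t (w t) <= phi t y.
Proof.
move=> mphi cphi ex.
have [D YD Dd] := separable_seq (ex_intro _ 0 Y0) Y_sep.
have [t|w mw wP] := measurable_minimizer mu Y_closed YD Dd mphi cphi.
  by have [y ? ?] := ex t; exists y.
by exists w => //; apply: filterS wP => t [].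
Qed.

(** The bound on [y] is only asked where the cost does not exceed that of [0]:
    since [0] belongs to [Y], minimizers satisfy this. *)
Lemma bochner_minimizer p (p1 : (1 <= p)%E) n (z : 'I_n -> bochner_fun mu X p1)
    (phi : T -> X -> R) (C : R) :
  (forall x, measurable_fun setT (phi ^~ x)) ->
  (forall t, continuous (phi t)) ->
  (forall t, exists2 y, Y y & forall y', Y y' -> phi t y <= phi t y') ->
  (forall t y, phi t y <= phi t 0 -> `|y| <= C * \sum_(i < n) `|z i t|) ->
  exists f : bochner_fun mu X p1, strongly_measurable Y f /\
    \forall t \ae mu, forall y, Y y -> phi t (f t) <= phi t y.
Proof.
move=> mphi cphi ex bd; have [w mw wP] := ae_minimizer mphi cphi ex.
have Lw : w \in bochner_pred mu p1.
  apply: (@bochner_dominated _ _ _ _ _ _ _ _ z C).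
    exact: sub_strongly_measurable mw.
  by apply: filterS wP => t /(_ _ Y0); exact: bd.
by exists (BochnerFun Lw).
Qed.

Lemma measurable_norm_subl p (p1 : (1 <= p)%E) (f : bochner_fun mu X p1) x :
  measurable_fun setT (fun t => `|x - f t|).
Proof.
apply/strongly_measurable_norm/strongly_measurableB; last exact: bochner_funP.
exact: strongly_measurable_constant.
Qed.

Section Fp.
Variables (p : R) (p1 : (1 <= p%:E)%E).

Let p_ge1 : 1 <= p. Proof. by rewrite -lee_fin. Qed.
Let p_gt0 : 0 < p. Proof. exact: lt_le_trans p_ge1. Qed.

Lemma Fp_centerP (Z : normedModType R) (W : set Z) :
  restricted_Fp_center_property p W <->
  forall n (z : 'I_n -> Z), (0 < n)%N -> exists2 w, W w &
    forall v, W v -> pow_sum p (fun i => `|w - z i|) <=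
                     pow_sum p (fun i => `|v - z i|).
Proof.
have F0 n (z : 'I_n -> Z) w : 0 <= F_p p (fun i => `|w - z i|).
  exact: powR_ge0.
split=> WP n z n0; have := WP n z n0.
  move=> /(inf_attainedP _ (F0 _ _))[w Ww wP]; exists w => // v /wP.
  by rewrite ler_Fp.
move=> [w Ww wP]; apply/(inf_attainedP _ (F0 _ _)); exists w => // v /wP.
by rewrite ler_Fp.
Qed.

Lemma Fp_center_lift : restricted_Fp_center_property p Y ->
  restricted_Fp_center_property p (Lp_sub mu p1 Y).
Proof.
move=> /Fp_centerP YP; apply/Fp_centerP => n Z n0.
pose z i : bochner_fun mu X p1 := repr (Z i).
have ZE i : Z i = Lp_class (z i) by rewrite Lp_classK.
pose phi t y := pow_sum p (fun i => `|y - z i t|).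
have [|t y|t|t y phi0|f [mf fP]] :=
  @bochner_minimizer _ p1 n z phi (n%:R + 1).
- move=> x; apply: measurable_sum => i.
  apply: (measurableT_comp (measurable_powR p)).
  by apply: measurableT_comp => //; exact: measurable_norm_subl.
- apply: (@cvg_big _ _ +%R 0 xpredT add_continuous) => i _.
  under eq_fun do rewrite normr_id; rewrite normr_id.
  apply: (@cvg_comp _ _ _ (fun y => y - z i t) (fun x => `|x| `^ p) _
    (nbhs (y - z i t))); last exact: continuous_norm_powR.
  by apply: cvgB; [exact: cvg_id|exact: cvg_cst].
- by have [y Yy yP] := YP n (z ^~ t) n0; exists y.
- set s := \sum_(i < n) _.
  have zs i : `|z i t| <= s by rewrite /s (bigD1 i)//= lerDl sumr_ge0.
  have s0 : 0 <= s by exact: sumr_ge0.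
  pose j := Ordinal n0.
  have : `|(`|y - z j t|)| <= n%:R * s.
    apply: (@pow_sum_le _ p _ (fun i => `|y - z i t|)) => //.
    apply: le_trans phi0 _; apply: ler_sum => i _.
    by rewrite ler_powR_iff// !normr_id sub0r normrN (ger0_norm s0).
  rewrite normr_id => ys; rewrite -[y](subrK (z j t)).
  by rewrite (le_trans (ler_normD _ _))// mulrDl mul1r lerD.
exists (Lp_class f); first by exists f.
move=> _ [g -> mg].
have -> : (fun i => `|Lp_class f - Z i|) =
    (fun i => `|Lp_class f - Lp_class (z i)|).
  by apply/funext => i; rewrite -ZE.
have -> : (fun i => `|Lp_class g - Z i|) =
    (fun i => `|Lp_class g - Lp_class (z i)|).
  by apply/funext => i; rewrite -ZE.
rewrite -lee_fin !Lp_pow_sum; apply: ae_ge0_le_integral => //.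
- by move=> t _; rewrite lee_fin pow_sum_ge0.
- by apply/measurable_EFinP; exact: measurable_pow_sum.
- by move=> t _; rewrite lee_fin pow_sum_ge0.
- by apply/measurable_EFinP; exact: measurable_pow_sum.
by apply: filterS fP => t ft _; rewrite lee_fin; apply: ft; case: mg.
Qed.

(** The average [a] of the pointwise costs of a center [f] in L_p is a lower
    bound for the cost of every [y] in [Y], by comparison with the constant
    function [y]; a point where the cost of [f] is at most [a] gives a center. *)
Lemma Fp_center_descend : restricted_Fp_center_property p (Lp_sub mu p1 Y) ->
  restricted_Fp_center_property p Y.
Proof.
move=> /Fp_centerP LP; apply/Fp_centerP => n z n0.
have /choice[c cE] (x : X) := constant_bochner mu p1 x.
have cxE x t : c x t = x by rewrite cE.
have [_ [f -> [Yf _]] fP] := LP n (fun i => Lp_class (c (z i))) n0.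
have mu_fin := fin_num_measure mu _ measurableT.
have m0 : 0 < fine (mu setT) by rewrite fine_gt0// mu_gt0 ltey_eq mu_fin.
pose a := pow_sum p (fun i => `|Lp_class f - Lp_class (c (z i))|) / fine (mu setT).
have aY y : Y y -> a <= pow_sum p (fun i => `|y - z i|).
  move=> Yy; rewrite ler_pdivrMr//.
  have cy : Lp_sub mu p1 Y (Lp_class (c y)).
    by exists (c y) => //; rewrite cE; exact: strongly_measurable_constant.
  apply: le_trans (fP _ cy) _.
  rewrite -lee_fin Lp_pow_sum EFinM fineK//.
  rewrite -integral_cst// le_eqVlt; apply/orP; left.
  apply/eqP/eq_integral => t _ /=; congr EFin.
  by apply: eq_bigr => i _; rewrite !cxE.
have [|||t ta] := @exists_le_average _ T R mu
   (fun t => pow_sum p (fun i => `|f t - c (z i) t|)) a mu_gt0.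
- exact: measurable_pow_sum.
- by rewrite divr_ge0 ?pow_sum_ge0// ltW.
- by rewrite -Lp_pow_sum -[mu setT](fineK mu_fin) -EFinM divfK ?gt_eqF.
exists (f t) => // y /aY; apply: le_trans.
by rewrite (le_trans _ ta)//; apply: ler_sum => i _; rewrite cxE.
Qed.

End Fp.

Section Chebyshev.

Let Loo := leey 1 : (1 <= +oo :> \bar R)%E.

Lemma Chebyshev_centerP (Z : normedModType R) (W : set Z) :
  restricted_weighted_Chebyshev_center_property W <->
  forall n (z : 'I_n -> Z) (rho : 'I_n -> R), (0 < n)%N ->
    (forall i, 0 <= rho i) -> exists2 w, W w &
    forall v, W v -> \big[Num.max/0]_(i < n) (rho i * `|w - z i|) <=
                     \big[Num.max/0]_(i < n) (rho i * `|v - z i|).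
Proof.
have F0 n (z : 'I_n -> Z) (rho : 'I_n -> R) w :
  0 <= \big[Num.max/0]_(i < n) (rho i * `|w - z i|) by exact: bigmax_ge_id.
split=> WP n z rho n0 rho0; have := WP n z rho n0 rho0.
  by move=> /(inf_attainedP _ (F0 _ _ _)).
by move=> ?; apply/(inf_attainedP _ (F0 _ _ _)).
Qed.

(** A maximum of finitely many essential suprema is the essential supremum of
    the pointwise maximum. *)
Lemma Linfty_bigmax_le n (rho : 'I_n -> R) (f : bochner_fun mu X Loo)
    (z : 'I_n -> bochner_fun mu X Loo) (M : R) : (forall i, 0 <= rho i) ->
  \big[Num.max/0]_(i < n) (rho i * `|Lp_class f - Lp_class (z i)|) <= M <->
  \forall t \ae mu, \big[Num.max/0]_(i < n) (rho i * `|f t - z i t|) <= M.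
Proof.
move=> rho0; have PF := @ae_properfilter_algebraOfSetsType _ _ _ mu mu_gt0.
split.
  move=> /bigmax_leP[M0 fM].
  have : forall i, \forall t \ae mu, rho i * `|f t - z i t| <= M.
    move=> i; have := (Linfty_norm_sub_le mu_gt0 _ _ _).1 (lexx `|Lp_class f - Lp_class (z i)|).
    apply: filterS => t ft; apply: le_trans (fM i isT).
    exact: ler_wpM2l.
  move=> /filter_forall; apply: filterS => t ft.
  by apply: bigmax_le => // i _; exact: ft.
move=> fM; have M0 : 0 <= M.
  by have [t] := filter_ex fM; apply: le_trans; exact: bigmax_ge_id.
apply: bigmax_le => // i _.
have [r0|r0] := eqVneq (rho i) 0; first by rewrite r0 mul0r.
have ri : 0 < rho i by rewrite lt_neqAle eq_sym r0/=.
rewrite mulrC -ler_pdivlMr//; apply/(Linfty_norm_sub_le mu_gt0).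
apply: filterS fM => t; rewrite ler_pdivlMr// mulrC; apply: le_trans.
exact: (le_bigmax _ (fun i => rho i * `|f t - z i t|)).
Qed.

Lemma Chebyshev_center_lift :
  restricted_weighted_Chebyshev_center_property Y ->
  restricted_weighted_Chebyshev_center_property (Lp_sub mu Loo Y).
Proof.
move=> /Chebyshev_centerP YP; apply/Chebyshev_centerP => n Z rho n0 rho0.
(* without a positive weight the cost is zero and bounds nothing: take [0] *)
have [[j rj]|nrho] := pselect (exists j, 0 < rho j); last first.
  have [c cE] := constant_bochner mu Loo (0 : X).
  exists (Lp_class c).
    by exists c => //; rewrite cE; exact: strongly_measurable_constant.
  move=> v _; apply: le_trans (bigmax_ge_id _ _ _ _).
  apply: bigmax_le => // i _; rewrite (_ : rho i = 0) ?mul0r//.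
  apply/eqP; rewrite eq_le rho0 andbT leNgt; apply/negP => ri.
  by apply: nrho; exists i.
pose z i : bochner_fun mu X Loo := repr (Z i).
have ZE i : Z i = Lp_class (z i) by rewrite Lp_classK.
pose phi t y := \big[Num.max/0]_(i < n) (rho i * `|y - z i t|).
have [|t y|t|t y phi0|f [mf fP]] :=
  @bochner_minimizer _ Loo n z phi ((rho j)^-1 * (\sum_i rho i) + 1).
- move=> x; rewrite /phi.
  elim: (index_enum _) => [|i s IH].
    by under eq_fun do rewrite big_nil; exact: measurable_cst.
  under eq_fun do rewrite big_cons; apply: measurable_maxr => //.
  by apply: measurable_funM => //; exact: measurable_norm_subl.
- apply: (@cvg_big R 'I_n Num.max 0 xpredT max_continuous) => i _.
  apply: cvgM; first exact: cvg_cst.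
  by apply: cvg_norm; apply: cvgB; [exact: cvg_id|exact: cvg_cst].
- by have [y Yy yP] := YP n (z ^~ t) rho n0 rho0; exists y.
- set s := \sum_(i < n) `|z i t|.
  have zs i : `|z i t| <= s by rewrite /s (bigD1 i)//= lerDl sumr_ge0.
  have s0 : 0 <= s by exact: sumr_ge0.
  have ys : `|y - z j t| <= (rho j)^-1 * (\sum_i rho i) * s.
    rewrite -mulrA ler_pdivlMl//.
    apply: le_trans (_ : phi t 0 <= _).
      apply: le_trans phi0.
      exact: (le_bigmax _ (fun i => rho i * `|y - z i t|)).
    apply: bigmax_le => [|i _]; first by rewrite mulr_ge0// sumr_ge0.
    rewrite sub0r normrN ler_pM// (bigD1 i)//= lerDl sumr_ge0//.
  rewrite -[y](subrK (z j t)).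
  by rewrite (le_trans (ler_normD _ _))// mulrDl mul1r lerD.
exists (Lp_class f); first by exists f.
move=> _ [g -> mg].
under eq_bigr do rewrite ZE; under [leRHS]eq_bigr do rewrite ZE.
apply/Linfty_bigmax_le => //.
have := (Linfty_bigmax_le g z _ rho0).1 (lexx _).
by apply: filterS2 fP => t ft; apply: le_trans; apply: ft; case: mg.
Qed.

Lemma Chebyshev_center_descend :
  restricted_weighted_Chebyshev_center_property (Lp_sub mu Loo Y) ->
  restricted_weighted_Chebyshev_center_property Y.
Proof.
move=> /Chebyshev_centerP LP; apply/Chebyshev_centerP => n z rho n0 rho0.
have /choice[c cE] (x : X) := constant_bochner mu Loo x.
have cxE x t : c x t = x by rewrite cE.
have [_ [f -> [Yf _]] fP] := LP n (fun i => Lp_class (c (z i))) rho n0 rho0.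
have PF := @ae_properfilter_algebraOfSetsType _ _ _ mu mu_gt0.
have [t ft] := filter_ex ((Linfty_bigmax_le f (c \o z) _ rho0).1 (lexx _)).
exists (f t) => // y Yy.
have cy : Lp_sub mu Loo Y (Lp_class (c y)).
  by exists (c y) => //; rewrite cE; exact: strongly_measurable_constant.
apply: le_trans (_ : \big[Num.max/0]_(i < n)
    (rho i * `|f t - (c \o z) i t|) <= _).
  by apply: le_bigmax2 => i _; rewrite /= cxE.
apply: (le_trans ft); apply: (le_trans (fP _ cy)).
apply/(Linfty_bigmax_le _ (c \o z)) => //; apply: aeW => t'.
by apply: le_bigmax2 => i _; rewrite /= !cxE.
Qed.

End Chebyshev.

End centers.

Theorem theorem3p2 (R : realType) (d : measure_display) (T : measurableType d)
    (mu : {finite_measure set T -> \bar R}) (mu_gt0 : (0 < mu setT)%E)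
    (X : completeNormedModType R) (Y : set X)
    (Y_lin : linear_subspace Y) (Y_closed : closed Y)
    (Y_sep : separable_set Y) :
  (restricted_weighted_Chebyshev_center_property Y <->
   restricted_weighted_Chebyshev_center_property
     (Lp_sub mu (leey 1 : (1 <= +oo :> \bar R)%E) Y)) /\
  (forall (p : R) (p1 : (1 <= p%:E)%E),
     restricted_Fp_center_property p Y <->
     restricted_Fp_center_property p (Lp_sub mu p1 Y)).
Proof.
have Y0 : Y 0 by case: Y_lin.
split; first split.
- exact: Chebyshev_center_lift.
- exact: Chebyshev_center_descend.
move=> p p1; split.
- exact: Fp_center_lift.
- exact: Fp_center_descend.
Qed.
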